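(* Let $C\subseteq\mathbb{R}^3$ be the cone spanned by $P_0=(-1,1,2)$, $P_1=(1,-1,1)$, $P_2=(0,1,0)$ and $P_3=(1,0,0)$. There is no finite subset $B\subseteq C\cap\mathbb{Z}^3$ which generates the monoid $C\cap\mathbb{Z}^3$ and is supernormal.
   Context: For a finite set $D$, $\mathrm{cone}(D)$ is the set of non-negative real combinations of $D$. A finite configuration $B\subseteq\mathbb{Z}^m$ is supernormal if for every subset $B'\subseteq B$, every point of $\mathrm{cone}(B')\cap\mathbb{Z}^m$ is a non-negative integer combination of the elements of $B\cap\mathrm{cone}(B')$. *)

(* Defs.v *)
From HB Require Import structures.
From mathcomp Require Import all_boot all_order all_algebra.
From mathcomp Require Import finmap.
From mathcomp Require Import boolp classical_sets reals.

Set Implicit Arguments.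
Unset Strict Implicit.
Unset Printing Implicit Defensive.

Import Order.TTheory GRing.Theory Num.Theory.
Local Open Scope classical_set_scope.
Local Open Scope fset_scope.
Local Open Scope ring_scope.

Definition cone (R : realType) (m : nat) (D : {fset 'rV[R]_m}) :
    set 'rV[R]_m :=
  [set x | exists2 c : 'rV[R]_m -> R,
      (forall d, d \in D -> 0 <= c d) & x = \sum_(d <- D) c d *: d].

Definition toR (R : realType) (m : nat) (z : 'rV[int]_m) : 'rV[R]_m :=
  map_mx intr z.

Definition lattice_points (R : realType) (m : nat) (K : set 'rV[R]_m) :
    set 'rV[int]_m :=
  [set z | K (toR R z)].

Definition int_cone (R : realType) (m : nat) (B : {fset 'rV[int]_m}) :
    set 'rV[R]_m :=
  cone [fset toR R b | b in B].

Arguments int_cone R {m} B _.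

(* The non-negative integer combinations of A, that is, the submonoid of Z^m
   generated by A. *)
Definition nat_span (m : nat) (A : {fset 'rV[int]_m}) : set 'rV[int]_m :=
  [set z | exists n : 'rV[int]_m -> nat, z = \sum_(a <- A) a *+ n a].

Definition supernormal (R : realType) (m : nat) (B : {fset 'rV[int]_m}) : Prop :=
  forall B' : {fset 'rV[int]_m}, B' `<=` B ->
    (lattice_points (int_cone R B') `<=`
       nat_span [fset b in B | `[< lattice_points (int_cone R B') b >] ])%classic.

Definition vec3 (T : Type) (x y z : T) : 'rV[T]_3 :=
  \row_(j < 3) nth x [:: x; y; z] j.

Definition P0 (R : realType) : 'rV[R]_3 := vec3 (-1) 1 2.
Definition P1 (R : realType) : 'rV[R]_3 := vec3 1 (-1) 1.
Definition P2 (R : realType) : 'rV[R]_3 := vec3 0 1 0.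
Definition P3 (R : realType) : 'rV[R]_3 := vec3 1 0 0.

Definition coneC (R : realType) : set 'rV[R]_3 :=
  cone [fset P0 R; P1 R; P2 R; P3 R].

Arguments coneC R _ : clear implicits.

(* Main.v *)
(* A supernormal generating set B of the cone contains every lattice point that is
   irreducible in the cone of some subset of B. The P_i are irreducible in C, so
   they lie in B. Put q_k = (1,0,k) and s_k = (0,1,k). Then s_(k+1) is irreducible in
   cone(P_0, P_2, q_k) and q_k is irreducible in cone(P_1, P_3, s_k), so starting
   from q_0 = P_3 all the q_k are forced into B, which is therefore infinite.

   Both irreducibility claims are instances of one fact: if (u, w, p) is a lattice
   basis and (N+1) p = N (u + w) + v, then p is irreducible in cone(u, v, w). *)
Require Import Defs.
From HB Require Import structures.
From mathcomp Require Import all_boot all_order all_algebra.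
From mathcomp Require Import finmap.
From mathcomp Require Import boolp classical_sets reals.
From mathcomp Require Import zify.

Set Implicit Arguments.
Unset Strict Implicit.
Unset Printing Implicit Defensive.

Import Order.TTheory GRing.Theory Num.Theory.
Local Open Scope fset_scope.
Local Open Scope ring_scope.

(** * Real cones and their lattice points *)

Section Cones.
Variables (R : realType) (m : nat).
Implicit Types (D : {fset 'rV[R]_m}) (A : {fset 'rV[int]_m}) (l : 'cV[int]_m).

Lemma mem_cone D d : d \in D -> cone D d.
Proof.
move=> dD; exists (fun e => (e == d)%:R) => [e _|]; first exact: ler0n.
rewrite (bigD1_seq d) ?fset_uniq //= eqxx scale1r big1 ?addr0 // => e /negPf->.
by rewrite scale0r.
Qed.

Lemma coneD D x y : cone D x -> cone D y -> cone D (x + y).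
Proof.
move=> [c c0 ->] [e e0 ->]; exists (fun d => c d + e d) => [d dD|].
  by rewrite addr_ge0 ?c0 ?e0.
by rewrite -big_split; apply: eq_bigr => d _; rewrite scalerDl.
Qed.

Lemma coneZ D (t : R) x : 0 <= t -> cone D x -> cone D (t *: x).
Proof.
move=> t0 [c c0 ->]; exists (fun d => t * c d) => [d dD|].
  by rewrite mulr_ge0 ?c0.
by rewrite scaler_sumr; apply: eq_bigr => d _; rewrite scalerA.
Qed.

Lemma toRD (x y : 'rV[int]_m) : toR R (x + y) = toR R x + toR R y.
Proof. exact: map_mxD. Qed.

Lemma toRMn (x : 'rV[int]_m) n : toR R (x *+ n) = n%:R *: toR R x.
Proof. by apply/rowP => j; rewrite !mxE mulmxnE rmorphMn mulr_natl. Qed.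

Lemma lattice_cone_mem A a : a \in A -> lattice_points (int_cone R A) a.
Proof. by move=> aA; apply/mem_cone/in_imfset. Qed.

Lemma lattice_coneD A x y :
  lattice_points (int_cone R A) x -> lattice_points (int_cone R A) y ->
  lattice_points (int_cone R A) (x + y).
Proof. by rewrite /lattice_points /= toRD; apply: coneD. Qed.

Lemma lattice_coneMn A x n :
  lattice_points (int_cone R A) x -> lattice_points (int_cone R A) (x *+ n).
Proof. by rewrite /lattice_points /= toRMn; apply: coneZ. Qed.

Lemma lattice_cone_divn A x n :
  lattice_points (int_cone R A) (x *+ n.+1) -> lattice_points (int_cone R A) x.
Proof.
rewrite /lattice_points /= toRMn => /(@coneZ _ n.+1%:R^-1).
by rewrite scalerA mulVf ?pnatr_eq0 // scale1r; apply; rewrite invr_ge0.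
Qed.

Lemma lattice_cone_ge0 A l z :
  (forall a, a \in A -> 0 <= (a *m l) 0 0) ->
  lattice_points (int_cone R A) z -> 0 <= (z *m l) 0 0.
Proof.
move=> l0 [c c0 zE]; rewrite -(ler0z R).
have toRl (x : 'rV[int]_m) :
    (toR R x *m map_mx intr l) 0 0 = ((x *m l) 0 0)%:~R.
  by rewrite /toR -map_mxM mxE.
rewrite -toRl zE mulmx_suml summxE big_seq sumr_ge0 // => d dA.
rewrite -scalemxAl mxE mulr_ge0 ?c0 //.
by case/imfsetP: dA => a /= aA ->; rewrite toRl ler0z l0.
Qed.

End Cones.

(** Some term of the combination is nonzero; splitting off one copy of its generator [a] leaves a
    remainder on which [L] is still non-negative, so irreducibility makes it zero. Describing the
    cone by inequalities [L] turns irreducibility into integer arithmetic. *)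
Lemma nat_span_irreducible m (A : {fset 'rV[int]_m}) (L : seq 'cV[int]_m) z :
  let nonneg x := forall l, l \in L -> 0 <= (x *m l) 0 0 in
  nat_span A z -> z != 0 -> (forall a, a \in A -> nonneg a) ->
  (forall x y, nonneg x -> nonneg y -> z = x + y -> x = 0 \/ y = 0) -> z \in A.
Proof.
move=> nonneg [n zE] z0 A0 irr.
have [a aA na0] : exists2 a, a \in A & a *+ n a != 0.
  apply: contrapT => h; move/eqP: z0; apply; rewrite zE big_seq big1 // => a aA.
  by apply: contrapT => /eqP na0; apply: h; exists a.
have nonnegMn x k : nonneg x -> nonneg (x *+ k).
  by move=> x0 l lL; rewrite -scaler_nat -scalemxAl mxE mulr_ge0 ?x0 ?ler0n.
have nonnegD x y : nonneg x -> nonneg y -> nonneg (x + y).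
  by move=> x0 y0 l lL; rewrite mulmxDl mxE addr_ge0 ?x0 ?y0.
pose r := a *+ (n a).-1 + \sum_(b <- A | b != a) b *+ n b.
have n_gt0 : (0 < n a)%N by case: (n a) na0; rewrite ?mulr0n ?eqxx.
have zar : z = a + r.
  by rewrite zE (bigD1_seq a) ?fset_uniq //= addrA -mulrS prednK.
have r0 : nonneg r.
  apply: (nonnegD _ _ (nonnegMn _ _ (A0 _ aA))).
  rewrite big_seq_cond; apply: (big_ind nonneg) => [l _|//|b /andP[bA _]].
    by rewrite mul0mx mxE.
  exact: (nonnegMn _ _ (A0 _ bA)).
case: (irr a r (A0 a aA) r0 zar) => [a0|re0]; last by rewrite zar re0 addr0.
by rewrite a0 mul0rn eqxx in na0.
Qed.

(* The integer coordinates of [v] in the basis [(u, w, p)] are [(-N, -N, N+1)],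
   so each facet of the cone of [u, v, w] bounds a coordinate from below in terms
   of the [p]-coordinate. Writing [p = x + y] inside the cone, one of [x], [y] has
   [p]-coordinate 0 and then both remaining coordinates vanish. *)
Lemma supernormal_basis_mem (R : realType) (B : {fset 'rV[int]_3})
    (U W : 'M[int]_3) (N : nat) :
  let u := row 0 U in let w := row 1 U in let p := row 2%:R U in
  let v := p *+ N.+1 - (u + w) *+ N in
  supernormal R B -> U *m W = 1%:M ->
  u \in B -> w \in B -> v \in B -> p \in B.
Proof.
move=> u w p v snB UW uB wB vB.
(* [c x j] is the j-th coordinate of [x] in the basis of rows of [U]. *)
pose c (x : 'rV[int]_3) j := (x *m col j W) 0 0.
have cD x y j : c (x + y) j = c x j + c y j by rewrite /c mulmxDl mxE.
have crow i j : c (row i U) j = (i == j)%:R.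
  rewrite /c; move/matrixP/(_ i j): UW; rewrite !mxE => <-.
  by apply: eq_bigr => k _; rewrite !mxE.
have c0 x : (forall j, c x j = 0) -> x = 0.
  move=> cx; rewrite -[x]mulmx1 -(mulmx1C UW) mulmxA.
  suff -> : x *m W = 0 by rewrite mul0mx.
  apply/rowP => j; rewrite [RHS]mxE -(cx j) /c !mxE.
  by apply: eq_bigr => k _; rewrite !mxE.
(* Facet functionals of cone(u, v, w): [f 0] vanishes on [w] and [v], [f 1] on [u] and [v], and
   [col 2 W] on [u] and [w]. *)
pose f j := col j W *+ N.+1 + col 2%:R W *+ N.
pose L := [:: f 0; f 1; col 2%:R W].
pose B' := [fset u; v; w].
have fE x j : (x *m f j) 0 0 = c x j *+ N.+1 + c x 2%:R *+ N.
  by rewrite /f mulmxDr mxE !(raddfMn (mulmx x)) !mulmxnE.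
have cMn x n j : c (x *+ n) j = c x j *+ n.
  by rewrite -mulmxnE -(raddfMn (mulmxr (col j W))).
have cv j : c v j = (2%:R == j)%:R *+ N.+1 - ((0 == j)%:R + (1 == j)%:R) *+ N.
  rewrite -!crow -cD -!cMn; apply/eqP; rewrite eq_sym subr_eq -cD.
  by rewrite /v subrK.
(* Divide (N+1) p = v + N (u + w) by N+1. *)
have pcone : lattice_points (int_cone R B') p.
  apply: (@lattice_cone_divn _ _ _ _ N); rewrite -[p *+ _](addrNK ((u + w) *+ N)).
  apply: lattice_coneD; first by apply: lattice_cone_mem; rewrite !inE eqxx orbT.
  by apply/lattice_coneMn/lattice_coneD; apply: lattice_cone_mem;
    rewrite !inE eqxx ?orbT.
have B'B : B' `<=` B.
  by apply/fsubsetP => x; rewrite !inE => /orP[/orP[]|] /eqP->.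
have := snB B' B'B p pcone.
move/(@nat_span_irreducible _ _ L) => irr.
suff : p \in [fset b in B | `[< lattice_points (int_cone R B') b >]].
  by rewrite !inE => /andP[].
apply: irr => [|a|x y x0 y0 pE].
- apply/eqP => p0; have := crow 2%:R 2%:R.
  by rewrite -/p p0 /c mul0mx mxE.
- rewrite !inE => /andP[_ /asboolP aC] l lL; apply: lattice_cone_ge0 aC => b.
  move: lL; rewrite !inE => lL /orP[/orP[]|] /eqP-> {b};
    case/or3P: lL => /eqP-> {l}; rewrite ?fE -/(c _ _) ?cv ?crow /=; lia.
- have cxy j : c x j + c y j = (2%:R == j)%:R by rewrite -cD -pE crow.
  have nonneg z : (forall l, l \in L -> 0 <= (z *m l) 0 0) ->
      [/\ 0 <= c z 0 *+ N.+1 + c z 2%:R *+ N, 0 <= c z 1 *+ N.+1 + c z 2%:R *+ N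
         & 0 <= c z 2%:R].
    by move=> z0; rewrite -!fE; split; apply: z0; rewrite !inE eqxx ?orbT.
  move: (cxy 0) (cxy 1) (cxy 2%:R) (nonneg x x0) (nonneg y y0) => /=.
  move=> c1 c2 c3 [x1 x2 x3] [y1 y2 y3].
  have ord3 z : c z 0 = 0 -> c z 1 = 0 -> c z 2%:R = 0 -> z = 0.
    move=> z0 z1 z2; apply: c0 => -[[|[|[|//]]] lt3].
    - by rewrite -z0; congr c; apply: val_inj.
    - by rewrite -z1; congr c; apply: val_inj.
    - by rewrite -z2; congr c; apply: val_inj.
  (* The p-coordinates are non-negative and sum to 1. The summand with p-coordinate 0 has its other
     coordinates at least 0; those of the other summand are at least -N/(N+1), hence at least 0 by
     integrality. They sum to 0, so all vanish. *)
  case: (eqVneq (c x 2%:R) 0) => cx2; [left|right]; apply: ord3; nia.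
Qed.

Definition mat3 (u w p : 'rV[int]_3) : 'M[int]_3 :=
  \matrix_(i < 3) nth 0 [:: u; w; p] i.

Lemma eq_rV3 (T : Type) (x y : 'rV[T]_3) :
  x 0 0 = y 0 0 -> x 0 1 = y 0 1 -> x 0 2%:R = y 0 2%:R -> x = y.
Proof.
move=> e0 e1 e2; apply/rowP => -[[|[|[|//]]] lt3].
- by rewrite (_ : Ordinal lt3 = 0) //; apply: val_inj.
- by rewrite (_ : Ordinal lt3 = 1) //; apply: val_inj.
- by rewrite (_ : Ordinal lt3 = 2%:R) //; apply: val_inj.
Qed.

Lemma toR_vec3 (R : realType) (x y z : int) :
  toR R (vec3 x y z) = vec3 x%:~R y%:~R z%:~R.
Proof. by apply: eq_rV3; rewrite !mxE. Qed.

Lemma mulmx_vec3 (z : 'rV[int]_3) (a b c : int) :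
  (z *m (vec3 a b c)^T) 0 0 = z 0 0 * a + z 0 1 * b + z 0 2%:R * c.
Proof.
rewrite mxE !big_ord_recl big_ord0 !mxE /= addr0 addrA.
by congr (_ + z 0 _ * _ + z 0 _ * _); apply: val_inj.
Qed.

(** * The infinite chain of forced generators *)

Section NoSupernormalGenerators.
Variables (R : realType) (B : {fset 'rV[int]_3}).
Hypothesis BC : forall b, b \in B -> lattice_points (coneC R) b.
Hypothesis spanB : nat_span B = lattice_points (coneC R).
Hypothesis snB : supernormal R B.

Let P : {fset 'rV[int]_3} :=
  [fset vec3 (-1) 1 2%:R; vec3 1 (-1) 1; vec3 0 1 0; vec3 1 0 0].

Let coneC_int : coneC R = int_cone R P.
Proof.
rewrite /coneC /int_cone; congr cone.
by rewrite /P !imfsetU !imfset_fset1 !toR_vec3 !rmorphN.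
Qed.

(** Inner normals of the facets of C through P_2, P_3; P_0, P_1; P_1, P_3; and P_0, P_2, in this
    order. *)
Let facets : seq 'cV[int]_3 :=
  [:: (vec3 0 0 1)^T; (vec3 1 1 0)^T; (vec3 0 1 1)^T; (vec3 2%:R 0 1)^T].

(** Two facet functionals vanish on each P_i, hence on both summands of a decomposition of it in C.
    The summands then lie on the ray of the primitive vector P_i, and one of them is 0. *)
Lemma generator_mem z : z \in P -> z \in B.
Proof.
move=> zP.
have zC : nat_span B z by rewrite spanB coneC_int; apply: lattice_cone_mem.
apply: (@nat_span_irreducible _ _ facets) zC _ _ _.
- by move: zP; rewrite !inE => /orP[/orP[/orP[]|]|] /eqP->; apply/eqP => /rowP h;
    move: (h 0) (h 1) (h 2%:R); rewrite !mxE /=; lia.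
- move=> b /BC; rewrite coneC_int => bC l lF; apply: lattice_cone_ge0 bC => a.
  by move: lF; rewrite !inE => /or4P[] /eqP->;
    move=> /orP[/orP[/orP[]|]|] /eqP->; rewrite mulmx_vec3 !mxE.
have coords (x : 'rV[int]_3) : (forall l, l \in facets -> 0 <= (x *m l) 0 0) ->
    [/\ 0 <= x 0 2%:R, 0 <= x 0 0 + x 0 1, 0 <= x 0 1 + x 0 2%:R
       & 0 <= x 0 0 * 2%:R + x 0 2%:R].
  move=> x0; split.
  - by have := x0 (vec3 0 0 1)^T; rewrite mulmx_vec3 !inE eqxx ?orbT; lia.
  - by have := x0 (vec3 1 1 0)^T; rewrite mulmx_vec3 !inE eqxx ?orbT; lia.
  - by have := x0 (vec3 0 1 1)^T; rewrite mulmx_vec3 !inE eqxx ?orbT; lia.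
  - by have := x0 (vec3 2%:R 0 1)^T; rewrite mulmx_vec3 !inE eqxx ?orbT; lia.
move=> x y /coords[x1 x2 x3 x4] /coords[y1 y2 y3 y4] /rowP e.
suff [[]|[]] : [/\ x 0 0 = 0, x 0 1 = 0 & x 0 2%:R = 0] \/
               [/\ y 0 0 = 0, y 0 1 = 0 & y 0 2%:R = 0].
- by move=> *; left; apply: eq_rV3; rewrite mxE.
- by move=> *; right; apply: eq_rV3; rewrite mxE.
suff : x 0 0 = 0 /\ x 0 1 = 0 /\ x 0 2%:R = 0 \/
       y 0 0 = 0 /\ y 0 1 = 0 /\ y 0 2%:R = 0.
  by move=> [[? []]|[? []]]; [left|right].
move: (e 0) (e 1) (e 2%:R) zP; rewrite !inE !mxE => e0 e1 e2.
by move=> /orP[/orP[/orP[]|]|] /eqP zE; move: e0 e1 e2; rewrite zE !mxE /=; lia.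
Qed.

Let q (k : nat) : 'rV[int]_3 := vec3 1 0 k%:Z.
Let s (k : nat) : 'rV[int]_3 := vec3 0 1 k%:Z.

(** Rests on (k+1) q_k = k (P_1 + s_k) + P_3, so N = k. *)
Lemma q_step k : s k \in B -> q k \in B.
Proof.
move=> sB.
(* The integer inverse of the matrix with rows P_1, s_k, q_k, certifying a lattice basis. *)
pose W : 'M[int]_3 :=
  (mat3 (vec3 (- k%:Z) (- k%:Z) 1) (vec3 (- k%:Z) (1 - k%:Z) 1)
        (vec3 (1 + k%:Z) k%:Z (-1)))^T.
have := @supernormal_basis_mem R B (mat3 (vec3 1 (-1) 1) (s k) (q k)) W k snB.
rewrite !rowK /=; apply=> //.
- apply/matrixP => -[[|[|[|//]]] i3] -[[|[|[|//]]] j3];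
    rewrite !mxE !big_ord_recl big_ord0 !mxE /=; lia.
- by apply: generator_mem; rewrite !inE eqxx ?orbT.
- rewrite (_ : _ - _ = vec3 1 0 0); first
    by apply: generator_mem; rewrite !inE eqxx ?orbT.
  by apply: eq_rV3; rewrite mxE [X in _ + X]mxE !mulmxnE !mxE /=; lia.
Qed.

(** Rests on (k+2) s_(k+1) = (k+1) (P_0 + q_k) + P_2, so N = k+1. *)
Lemma s_step k : q k \in B -> s k.+1 \in B.
Proof.
move=> qB.
pose W : 'M[int]_3 :=
  (mat3 (vec3 (- k%:Z) (- k.+1%:Z) 1) (vec3 (1 - k%:Z) (- k.+1%:Z) 1)
        (vec3 k%:Z k.+2%:Z (-1)))^T.
have := @supernormal_basis_mem R B
  (mat3 (vec3 (-1) 1 2%:R) (q k) (s k.+1)) W k.+1 snB.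
rewrite !rowK /=; apply=> //.
- apply/matrixP => -[[|[|[|//]]] i3] -[[|[|[|//]]] j3];
    rewrite !mxE !big_ord_recl big_ord0 !mxE /=; lia.
- by apply: generator_mem; rewrite !inE eqxx ?orbT.
- rewrite (_ : _ - _ = vec3 0 1 0); first
    by apply: generator_mem; rewrite !inE eqxx ?orbT.
  by apply: eq_rV3; rewrite mxE [X in _ + X]mxE !mulmxnE !mxE /=; lia.
Qed.

Lemma q_mem k : q k \in B.
Proof.
elim: k => [|k /s_step/q_step //].
by apply: generator_mem; rewrite !inE eqxx ?orbT.
Qed.

Lemma no_supernormal_generators : False.
Proof.
(* Pigeonhole: one more [q k] than [B] has elements, told apart by their last coordinate. *)
pose r := [seq q k | k <- iota 0 (size B).+1].
suff : (size r <= size B)%N by rewrite size_map size_iota ltnn.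
apply: uniq_leq_size => [|_ /mapP[k _ ->]]; last exact: q_mem.
rewrite map_inj_uniq ?iota_uniq // => i j /rowP/(_ 2%:R).
by rewrite !mxE /= => -[].
Qed.

End NoSupernormalGenerators.

Theorem theorem2p3 (R : realType) :
  ~ exists B : {fset 'rV[int]_3},
      [/\ (forall b, b \in B -> lattice_points (coneC R) b),
          nat_span B = lattice_points (coneC R) &
          supernormal R B].
Proof. by move=> [B [BC spanB snB]]; apply: no_supernormal_generators snB. Qed.
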